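(* Let $N>2$ be odd, and let $g:\mathcal W\to\mathbb R$, $g(\mathbf W):=\frac12\|\mathbf W_1\mathbf W_2\cdots \mathbf W_N\mathbf X-\mathbf Y\|_F^2$. Define $$H_1(\mathbf W):=\left(\frac{\|\mathbf W\|_F^2}{N}\right)^N,\qquad H_3(\mathbf W):=\left(\frac{\|\mathbf W\|_F^2+1}{N+1}\right)^{\frac{N+1}2}.$$ Then, for $L=1$, the function $g$ satisfies the $L$-smad property (on $\mathcal W$) with respect to the kernel generating distance $$H_b(\mathbf W)=c_1(N)H_1(\mathbf W)+c_3(N)H_3(\mathbf W),$$ where $$c_1(N)=\frac{(2N-1)N^N}{2\,N!}\|\mathbf X\|_F^2,\qquad c_3(N)=\frac{\|\mathbf Y\|_F\|\mathbf X\|_F(N-1)(N+1)^{\frac{N-1}{2}}}{(N-1)^{\frac{N-1}{2}}}.$$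
   Context: Setting: $N\ge2$ is an integer, $d_1,\dots,d_N,d,n_T$ are positive integers, $d_{N+1}:=d$, $\mathcal W_i:=\mathbb R^{d_i\times d_{i+1}}$, and $\mathcal W:=\mathcal W_1\times\cdots\times\mathcal W_N$ (viewed as a Euclidean space), with elements $\mathbf W=(\mathbf W_1,\dots,\mathbf W_N)$ and norm $\|\mathbf W\|_F^2:=\sum_{i=1}^N\|\mathbf W_i\|_F^2$. The matrices $\mathbf X\in\mathbb R^{d\times n_T}$ and $\mathbf Y\in\mathbb R^{d_1\times n_T}$ are fixed. Kernel generating distance: a function $h:\mathbb R^m\to(-\infty,+\infty]$ is a kernel generating distance associated with a nonempty convex open set $C$ if (i) $h$ is proper, lower semicontinuous and convex, with $\mathrm{dom}\,h\subset\overline C$ and $\mathrm{dom}\,\partial h=C$; (ii) $h$ is $C^1$ on $\mathrm{int}\,\mathrm{dom}\,h=C$. Here $C$ is the whole space. $L$-smad property: a continuously differentiable function $g$ satisfies the $L$-smad property with respect to $h$ (equivalently, $(g,h)$ is $L$-smooth adaptable), for $L>0$, if both $Lh-g$ and $Lh+g$ are convex on the whole space. *)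

(* Defs.v *)
From HB Require Import structures.
From mathcomp Require Import all_boot all_order all_algebra.
From mathcomp Require Import all_classical all_reals all_analysis.
Set Implicit Arguments.
Unset Strict Implicit.
Unset Printing Implicit Defensive.
Import Order.TTheory GRing.Theory Num.Theory.
Import numFieldNormedType.Exports.
Local Open Scope classical_set_scope.
Local Open Scope ring_scope.

Section Euclidean.
Context {R : realType} {m : nat}.
Implicit Types (f g : 'rV[R]_m -> R) (h : 'rV[R]_m -> \bar R).
Implicit Types (x y v : 'rV[R]_m) (C : set 'rV[R]_m).

Definition dotv x y : R := \sum_(i < m) x 0 i * y 0 i.

Definition gradient f x : 'rV[R]_m := \row_i 'D_(delta_mx 0 i) f x.

(* To be used with an open C: membership in C is open, so no relative topology
   is needed for the continuity of the gradient. *)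
Definition C1_on C f : Prop :=
  forall x, C x -> differentiable f x /\ {for x, continuous (gradient f)}.

Definition dom h : set 'rV[R]_m := [set x | (h x < +oo)%E].

Definition proper h : Prop :=
  (exists x, dom h x) /\ (forall x, (-oo < h x)%E).

(* Only meant for functions that never take the value -oo, so that the
   right-hand side is never of the form oo - oo. *)
Definition convex_ereal h : Prop :=
  forall x y (t : R), 0 < t < 1 ->
    (h (t *: x + (1 - t) *: y)%R <= t%:E * h x + (1 - t)%:E * h y)%E.

Definition subdifferential h x : set 'rV[R]_m :=
  [set v | dom h x /\ forall y, (h x + (dotv v (y - x)%R)%:E <= h y)%E].

Definition dom_subdifferential h : set 'rV[R]_m :=
  [set x | subdifferential h x !=set0].

Record kernel_generating_distance C h : Prop := {
  kgd_nonempty : C !=set0;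
  kgd_convex_set : convex_set C;
  kgd_open : open C;
  kgd_proper : proper h;
  kgd_lsc : lower_semicontinuous h;
  kgd_convex : convex_ereal h;
  kgd_dom : dom h `<=` closure C;
  kgd_dom_subdifferential : dom_subdifferential h = C;
  kgd_interior_dom : interior (dom h) = C;
  kgd_C1 : C1_on C (fine \o h)
}.

(* The kernel is real-valued here: this is the case C = R^m, in which
   dom h = R^m. *)
Record smad (L : R) g f : Prop := {
  smad_gt0 : 0 < L;
  smad_C1 : C1_on setT g;
  smad_sub : convex_function setT (fun x => L * f x - g x);
  smad_add : convex_function setT (fun x => L * f x + g x)
}.

End Euclidean.

Section Network.
Context {R : realType}.

Definition frob m n (A : 'M[R]_(m, n)) : R :=
  Num.sqrt (\sum_i \sum_j A i j ^+ 2).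

(* Layers are indexed from 0, so that d 0, ..., d N are the N + 1 dimensions;
   the values of d beyond N are irrelevant. *)
Definition weights (N : nat) (d : nat -> nat) : Type :=
  forall i : 'I_N, 'M[R]_(d i, d i.+1).

(* W_0 *m ... *m W_(N-1) *)
Fixpoint mxprod (N : nat) (d : nat -> nat) :
    weights N d -> 'M[R]_(d 0%N, d N) :=
  match N with
  | 0 => fun=> 1%:M
  | n.+1 => fun W =>
      mxprod (fun i : 'I_n => W (widen_ord (leqnSn n) i)) *m W ord_max
  end.

Definition normsq N d (W : weights N d) : R := \sum_i frob (W i) ^+ 2.

Section Loss.
Variables (N : nat) (d : nat -> nat) (nT : nat).
Variables (X : 'M[R]_(d N, nT)) (Y : 'M[R]_(d 0%N, nT)).
Implicit Type W : weights N d.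

Definition loss W : R := 2^-1 * frob (mxprod W *m X - Y) ^+ 2.

Definition H1 W : R := (normsq W / N%:R) ^+ N.

Definition H3 W : R :=
  ((normsq W + 1) / (N%:R + 1)) `^ ((N%:R + 1) / 2).

Definition c1 : R :=
  (2 * N%:R - 1) * N%:R ^+ N / (2 * N`!%:R) * frob X ^+ 2.

Definition c3 : R :=
  frob Y * frob X * (N%:R - 1) * (N%:R + 1) `^ ((N%:R - 1) / 2)
  / (N%:R - 1) `^ ((N%:R - 1) / 2).

Definition Hb W : R := c1 * H1 W + c3 * H3 W.

End Loss.

(* The space of weights as a Euclidean space R^m: the entries of the layers
   are listed one layer after the other, row by row. *)

Definition wdim (N : nat) (d : nat -> nat) : nat :=
  (\sum_(i < N) d i * d i.+1)%N.

Definition weights_of_vec N d (x : 'rV[R]_(wdim N d)) : weights N d :=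
  fun i => vec_mx (@submxrow _ N (fun i => (d i * d i.+1)%N) 1 x i).

Definition vec_of_weights N d (W : weights N d) : 'rV[R]_(wdim N d) :=
  \mxrow_i mxvec (W i).

Lemma vec_of_weightsK N d :
  cancel (@vec_of_weights N d) (@weights_of_vec N d).
Proof.
move=> W; apply: functional_extensionality_dep => i.
by rewrite /weights_of_vec /vec_of_weights mxrowK mxvecK.
Qed.

Lemma weights_of_vecK N d :
  cancel (@weights_of_vec N d) (@vec_of_weights N d).
Proof.
move=> x; rewrite -[RHS](@submxrowK _ N (fun i => (d i * d i.+1)%N)).
by apply: eq_mxrow => i; rewrite vec_mxK.
Qed.

Lemma normsq_weights_of_vec N d (x : 'rV[R]_(wdim N d)) :
  normsq (weights_of_vec x) = dotv x x.
Proof.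
have frobE m n (v : 'rV[R]_(m * n)) : frob (vec_mx v) ^+ 2 = \sum_k v 0 k ^+ 2.
  rewrite sqr_sqrtr; last by do 2!apply: sumr_ge0 => ? _; rewrite sqr_ge0.
  rewrite pair_bigA /= (reindex _ (curry_mxvec_bij m n)) /=.
  by apply: eq_bigr => -[i j] _; rewrite mxE.
pose p (i : 'I_N) := (d i * d i.+1)%N.
transitivity (\sum_i \sum_(k < p i) x 0 (@tagnat.Rank N p i k) ^+ 2).
  by apply: eq_bigr => i _; rewrite frobE; apply: eq_bigr => k _; rewrite mxE.
rewrite sig_big_dep /dotv /= (reindex _ (@tagnat.rank_bij_on N p)) /=.
by apply: eq_bigr => -[i k] _; rewrite expr2.
Qed.

End Network.

(* Main.v *)
Require Import Defs.
From HB Require Import structures.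
From mathcomp Require Import all_boot all_order all_algebra.
From mathcomp Require Import ring lra.
From mathcomp Require Import all_classical all_reals all_analysis.
Set Implicit Arguments.
Unset Strict Implicit.
Unset Printing Implicit Defensive.
Import Order.TTheory GRing.Theory Num.Theory.
Import numFieldNormedType.Exports.
Local Open Scope classical_set_scope.
Local Open Scope ring_scope.

(** The loss and the kernel are polynomials in the entries of the weights, so
they are smooth, and every convexity claim reduces to the sign of a second
directional derivative: if f has a nonnegative second derivative along every
line, two uses of the mean value theorem give
f x + Df x (y - x) <= f y, which contains both the convexity of f and the
existence of a subgradient.  It is therefore enough to prove
|D2 g (W; V)| <= D2 H_b (W; V) for all weights W and directions V
(lemmas [lossD2_le] and [HbD2_ge]).

Let A be the product of the layers of W, and A', A'' its first and second
derivatives in the direction V.  With a_i = |W_i| and b_i = |V_i| (Frobenius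
norms), submultiplicativity bounds |A|, |A'| and |A''| by the value and the
first two derivatives at 0 of the scalar product prod_i (a_i + t b_i); write
e, e' and e'' for them.  Since
D2 g = |A' X|^2 + <A X, A'' X> - <Y, A'' X>, Cauchy-Schwarz gives
|D2 g| <= (e'^2 + e e'') |X|^2 + e'' |X| |Y|, and the two summands are matched
with the two parts of the kernel.

- Put p_i = b_i prod_(j != i) a_j.  Then e' is the sum of the p_i and e e'' is
the sum of the p_i p_j over i != j, so that
e'^2 + e e'' <= (2 N - 1) sum_i p_i^2.  By the arithmetic-geometric mean
inequality prod_(j != i) a_j^2 is at most (|W|^2 / (N - 1))^(N - 1), hence at
most |W|^(2 (N - 1)) / (N - 1)!, which produces the constant c_1.

- Each product of N - 2 norms in e'' is compared with
((|W|^2 + 1) / (N - 1))^((N - 1) / 2) by applying the same inequality to the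
N - 2 squares a_k^2 completed by the number 1.  This explains the shift by 1
in H_3 and produces the constant c_3; since N is odd, the exponent
(N - 1) / 2 is an integer and H_3 is a polynomial.

On the side of the kernel, H_1 and H_3 are increasing convex functions of
|W|^2, and it suffices to keep the term of their second derivative that is
proportional to |V|^2. *)

(** * Polynomial functions on a Euclidean space *)

Section PolynomialFunctions.
Context {R : realType} {m : nat}.
Implicit Types (f g : 'rV[R]_m -> R) (x v : 'rV[R]_m).

(** The directional derivatives of such a function are again of this form
([polyfun_derive]), so that continuity of the gradient comes for free. *)
Inductive polynomial_function : ('rV[R]_m -> R) -> Prop :=
| polyfun_cst c : polynomial_function (fun=> c)
| polyfun_coord i : polynomial_function (fun x => x 0 i)
| polyfun_add f g : polynomial_function f -> polynomial_function g ->
    polynomial_function (fun x => f x + g x)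
| polyfun_mul f g : polynomial_function f -> polynomial_function g ->
    polynomial_function (fun x => f x * g x).

Lemma polyfun_sum (I : finType) (f : I -> 'rV[R]_m -> R) :
  (forall i, polynomial_function (f i)) ->
  polynomial_function (fun x => \sum_i f i x).
Proof.
move=> pf; rewrite (_ : (fun _ => _) = \sum_i f i); last first.
  by apply/funext => x; rewrite fct_sumE.
elim/big_ind : _ => [|g h|i _]; last exact: pf.
- exact: polyfun_cst.
- exact: polyfun_add.
Qed.

Lemma polyfun_exp f n : polynomial_function f ->
  polynomial_function (fun x => f x ^+ n).
Proof.
move=> pf; elim: n => [|n IH]; first exact: polyfun_cst.
rewrite (_ : (fun _ => _) = fun x => f x * f x ^+ n); first exact: polyfun_mul.
by apply/funext => x; rewrite exprS.
Qed.

Lemma polyfun_differentiable f x : polynomial_function f -> differentiable f x.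
Proof.
elim=> [c|i|g h _ dg _ dh|g h _ dg _ dh].
- exact: differentiable_cst.
- exact: differentiable_coord.
- exact: differentiableD.
- exact: differentiableM.
Qed.

Lemma is_derive_coord x v i : is_derive x v (fun y : 'rV[R]_m => y 0 i) (v 0 i).
Proof.
apply: DeriveDef; first exact/diff_derivable/differentiable_coord.
rewrite deriveE; last exact: differentiable_coord.
have @c : {linear 'rV[R]_m -> R}.
  by exists (fun N : 'rV[R]_m => N 0 i); do 2![eexists]; do ?[constructor];
     rewrite ?mxE // => ? *; rewrite ?mxE //; move=> ?; rewrite !mxE.
by rewrite (_ : (fun _ => _) = c) // diff_lin //; apply: coord_continuous.
Qed.

Lemma polyfun_derive f v :
  polynomial_function f -> polynomial_function ('D_v f).
Proof.
elim=> [c|i|g h pg dg ph dh|g h pg dg ph dh].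
- rewrite (_ : 'D_v _ = fun=> 0); first exact: polyfun_cst.
  by apply/funext => x; exact: derive_cst.
- rewrite (_ : 'D_v _ = fun=> v 0 i); first exact: polyfun_cst.
  by apply/funext => x; have /@derive_val := is_derive_coord x v i.
- rewrite (_ : 'D_v _ = fun x => 'D_v g x + 'D_v h x); first exact: polyfun_add.
  apply/funext => x; apply: deriveD;
    exact/diff_derivable/polyfun_differentiable.
- rewrite (_ : 'D_v _ = fun x => g x * 'D_v h x + h x * 'D_v g x).
    by apply: polyfun_add; exact: polyfun_mul.
  apply/funext => x; apply: deriveM;
    exact/diff_derivable/polyfun_differentiable.
Qed.

Lemma polyfun_continuous f : polynomial_function f -> continuous f.
Proof.
by move=> pf x; exact/differentiable_continuous/polyfun_differentiable.
Qed.

Lemma polyfun_C1 f : polynomial_function f -> C1_on [set: 'rV[R]_m] f.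
Proof.
move=> pf x _; split; first exact: polyfun_differentiable.
have gradF : Filter (gradient f @ x).
  exact: (fmap_filter (gradient f) (nbhs_filter x)).
apply: (iffRL (@cvg_mx_entourageP R _ _ _ gradF _)) => A entA.
have near_coord (j : 'I_m) :
    \forall y \near x, A ('D_(delta_mx 0 j) f x, 'D_(delta_mx 0 j) f y).
  have cf := polyfun_continuous (polyfun_derive (delta_mx 0 j) pf) (x := x).
  by have /cvg_app_entourageP/(_ A entA) := cf.
have := filter_forall (nbhs_filter x) near_coord; apply: filterS => y Ay i j.
by rewrite !mxE inE.
Qed.

End PolynomialFunctions.

(** * Convexity from second derivatives along lines *)

Section Convexity.
Context {R : realType} {m : nat}.
Implicit Types (f g : 'rV[R]_m -> R) (x v : 'rV[R]_m).

Lemma is_derive_bigsum (I : finType) (f : I -> 'rV[R]_m -> R) (df : I -> R)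
    x v :
  (forall i, is_derive x v (f i) (df i)) ->
  is_derive x v (fun y => \sum_i f i y) (\sum_i df i).
Proof.
move=> dfi; rewrite (_ : (fun _ => _) = \sum_i f i); last first.
  by apply/funext => y; rewrite fct_sumE.
elim/big_ind2 : _ => // [|g dg h dh Hg Hh].
- exact: is_derive_cst.
- exact: is_deriveD.
Qed.

Lemma is_derive_mul (f g : 'rV[R]_m -> R) df dg x v :
  is_derive x v f df -> is_derive x v g dg ->
  is_derive x v (fun y => f y * g y) (df * g x + f x * dg).
Proof.
move=> Hf Hg; have Hfg := is_deriveM Hf Hg.
by rewrite addrC [df * _]mulrC; exact: Hfg.
Qed.

Lemma is_derive_scale (f : 'rV[R]_m -> R) (k df : R) x v :
  is_derive x v f df -> is_derive x v (fun y => k * f y) (k * df).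
Proof.
move=> Hf; have := is_derive_mul (is_derive_cst k x v) Hf.
by rewrite mul0r add0r.
Qed.

Lemma is_derive_line f x v t df : is_derive (x + t *: v) v f df ->
  is_derive t 1 (fun s : R => f (x + s *: v)) df.
Proof.
move=> [fd <-].
have E : (fun h : R => h^-1 *: (((fun s : R => f (x + s *: v)) \o shift t)
      (h *: 1) - f (x + t *: v))) =
    (fun h : R => h^-1 *: ((f \o shift (x + t *: v)) (h *: v) -
      f (x + t *: v))).
  apply/funext => h /=; congr (_ *: (f _ - _)).
  by rewrite scalerDl [_ *: 1]mulr1 addrCA.
by apply: DeriveDef; rewrite /derivable/derive E.
Qed.

Section gradient_inequality.
Variables (f : 'rV[R]_m -> R) (Df D2f : 'rV[R]_m -> 'rV[R]_m -> R).
Hypothesis f_derive : forall x v, is_derive x v f (Df x v).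
Hypothesis Df_derive : forall x v, is_derive x v (Df ^~ v) (D2f x v).
Hypothesis D2f_ge0 : forall x v, 0 <= D2f x v.

(** Along the segment from x to y the slope at 0 is at most the slope at the
point c where the mean value theorem realizes f y - f x, because the slope is
itself nondecreasing by a second use of that theorem. *)
Lemma gradient_inequality (x y : 'rV[R]_m) : f x + Df x (y - x) <= f y.
Proof.
set v := y - x.
pose phi (s : R) := f (x + s *: v); pose dphi (s : R) := Df (x + s *: v) v.
have dP (s : R) : is_derive s 1 phi (dphi s) by exact: is_derive_line.
have ddP (s : R) : is_derive s 1 dphi (D2f (x + s *: v) v).
  exact: (@is_derive_line (Df ^~ v)).
have cont (u u' : R -> R) (a b : R) : (forall s : R, is_derive s 1 u (u' s)) ->
    {within `[a, b], continuous u}.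
  move=> du; apply: continuous_subspaceT => s.
  by apply/differentiable_continuous/derivable1_diffP; have [] := du s.
have [c /andP[c0 c1] /= Ec] :=
  MVT (@ltr01 R) (fun s _ => dP s) (cont _ _ _ _ dP).
rewrite bnd_simp in c0.
have [e _ Ee] := MVT c0 (fun s _ => ddP s) (cont _ _ _ _ ddP).
have: dphi 0 <= dphi c.
  by rewrite -subr_ge0 Ee mulr_ge0 // subr0 ltW.
have -> : dphi c = f y - f x.
  move: Ec; rewrite subr0 mulr1 => <-.
  by rewrite /phi scale0r scale1r addr0 /v [x + _]addrC subrK.
by rewrite /dphi scale0r addr0 lerBrDl.
Qed.

Hypothesis f_diff : forall x, differentiable f x.

(** Average the gradient inequalities at z = t x + (1 - t) y, towards x and
towards y, with weights t and 1 - t: the linear terms cancel. *)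
Lemma convex_of_derive2_ge0 (x y : 'rV[R]_m) (t : R) : 0 <= t <= 1 ->
  f (t *: x + (1 - t) *: y) <= t * f x + (1 - t) * f y.
Proof.
move=> /andP[t0 t1]; set z := _ + _.
have Df_lin a u : Df z (a *: u) = a * Df z u.
  have Df_diff w : Df z w = 'd f z w.
    by rewrite -deriveE //; have [_ ->] := f_derive z w.
  by rewrite !Df_diff linearZ.
have xz : x - z = (1 - t) *: (x - y).
  by rewrite /z scalerBr [(1 - t) *: x]scalerBl scale1r opprD addrA.
have yz : y - z = (- t) *: (x - y).
  rewrite scaleNr scalerBr opprB /z [(1 - t) *: y]scalerBl scale1r opprD opprB.
  by rewrite addrCA [y + _]addrC subrK addrC.
have t1' : 0 <= 1 - t by rewrite subr_ge0.
have := lerD (ler_wpM2l t0 (gradient_inequality z x))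
             (ler_wpM2l t1' (gradient_inequality z y)).
rewrite xz yz !Df_lin; apply: le_trans.
by rewrite [leRHS](_ : _ = f z) //; ring.
Qed.

End gradient_inequality.

Lemma derive_gradient f x v :
  differentiable f x -> 'D_v f x = dotv (gradient f x) v.
Proof.
move=> df; rewrite deriveE // {1}[v]row_sum_delta linear_sum /dotv.
by apply: eq_bigr => i _; rewrite linearZ /= mxE deriveE // mulrC.
Qed.

Lemma convex_function_setT f :
  (forall x y (t : R), 0 <= t <= 1 ->
    f (t *: x + (1 - t) *: y) <= t * f x + (1 - t) * f y) ->
  convex_function [set: 'rV[R]_m] f.
Proof.
by move=> cf t x y _ _; apply: cf; rewrite ge0 le1.
Qed.

(** The convexity of f comes from the gradient inequality, which also says that
the gradient of f is a subgradient at every point. *)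
Lemma kgd_polyfun f (Df D2f : 'rV[R]_m -> 'rV[R]_m -> R) :
  polynomial_function f ->
  (forall x v, is_derive x v f (Df x v)) ->
  (forall x v, is_derive x v (Df ^~ v) (D2f x v)) ->
  (forall x v, 0 <= D2f x v) ->
  kernel_generating_distance [set: 'rV[R]_m] (fun x => (f x)%:E).
Proof.
move=> pf df ddf ddf0.
have fdiff x : differentiable f x by exact: polyfun_differentiable.
have domT : dom (fun x => (f x)%:E) = setT.
  by apply/seteqP; split => // x _; rewrite /dom /= ltry.
split.
- by exists 0.
- by move=> x y t _ _; rewrite in_setT.
- exact: openT.
- by split; [exists 0; rewrite domT|move=> x; exact: ltNyr].
- move=> x a; rewrite lte_fin => afx.
  have cf := polyfun_continuous pf (x := x).
  exists (f @^-1` [set y | a < y]); last by move=> y; rewrite lte_fin.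
  by apply: cf; exact: lt_nbhsr.
- move=> x y t /andP[t0 t1]; rewrite -!EFinM -EFinD lee_fin.
  by apply: (convex_of_derive2_ge0 df ddf ddf0 fdiff); rewrite !ltW.
- by rewrite closureT.
- apply/seteqP; split => // x _; exists (gradient f x); split.
    by rewrite domT.
  move=> y; rewrite -EFinD lee_fin -derive_gradient //.
  have [_ ->] := df x (y - x).
  exact: gradient_inequality df ddf ddf0 x y.
- by rewrite domT interiorT.
- exact: polyfun_C1.
Qed.

Lemma smad_polyfun (L : R) f g (Df D2f Dg D2g : 'rV[R]_m -> 'rV[R]_m -> R) :
  0 < L -> polynomial_function f -> polynomial_function g ->
  (forall x v, is_derive x v f (Df x v)) ->
  (forall x v, is_derive x v (Df ^~ v) (D2f x v)) ->
  (forall x v, is_derive x v g (Dg x v)) ->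
  (forall x v, is_derive x v (Dg ^~ v) (D2g x v)) ->
  (forall x v, `|D2g x v| <= L * D2f x v) -> smad L g f.
Proof.
move=> L0 pf pg df ddf dg ddg leD2.
have pLf : polynomial_function (fun x => L * f x).
  by apply: polyfun_mul => //; exact: polyfun_cst.
have dLf x v := is_derive_scale L (df x v).
have ddLf x v := is_derive_scale L (ddf x v).
split; [exact: L0|exact: polyfun_C1| |].
- apply: (@convex_function_setT ((fun x => L * f x) - g)) => x y t t01.
  apply: (@convex_of_derive2_ge0 ((fun x => L * f x) - g)
    (fun z v => L * Df z v - Dg z v)
    (fun z v => L * D2f z v - D2g z v)
    (fun z v => is_deriveB (dLf z v) (dg z v))
    (fun z v => is_deriveB (ddLf z v) (ddg z v)) _ _ _ _ _ t01) => z.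
  + by move=> v; rewrite subr_ge0 (le_trans (ler_norm _)).
  + by apply: differentiableB; exact: polyfun_differentiable.
- apply: (@convex_function_setT ((fun x => L * f x) + g)) => x y t t01.
  apply: (@convex_of_derive2_ge0 ((fun x => L * f x) + g)
    (fun z v => L * Df z v + Dg z v)
    (fun z v => L * D2f z v + D2g z v)
    (fun z v => is_deriveD (dLf z v) (dg z v))
    (fun z v => is_deriveD (ddLf z v) (ddg z v)) _ _ _ _ _ t01) => z.
  + move=> v; rewrite -lerBlDr sub0r.
    by apply: le_trans (leD2 z v); rewrite -normrN ler_norm.
  + by apply: differentiableD; exact: polyfun_differentiable.
Qed.

End Convexity.

(** * Sums and products of real numbers *)

Section SumsAndProducts.
Context {R : realFieldType}.

(** Lagrange's identity: the difference of the two sides is half the sum of the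
squares of the minors u i * v j - u j * v i. *)
Lemma sum_cauchy_schwarz (I : finType) (u v : I -> R) :
  (\sum_i u i * v i) ^+ 2 <= (\sum_i u i ^+ 2) * (\sum_i v i ^+ 2).
Proof.
have : 0 <= \sum_i \sum_j (u i * v j - u j * v i) ^+ 2.
  by do 2![apply: sumr_ge0 => ? _]; exact: sqr_ge0.
have -> : \sum_i \sum_j (u i * v j - u j * v i) ^+ 2 =
    2 * ((\sum_i u i ^+ 2) * (\sum_i v i ^+ 2) - (\sum_i u i * v i) ^+ 2).
  transitivity (\sum_i \sum_j (u i ^+ 2 * v j ^+ 2) +
      \sum_i \sum_j (u j ^+ 2 * v i ^+ 2) -
      2 * \sum_i \sum_j (u i * v i) * (u j * v j)).
    rewrite -big_split /= mulr_sumr -sumrB; apply: eq_bigr => i _.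
    rewrite -big_split /= mulr_sumr -sumrB; apply: eq_bigr => j _; ring.
  rewrite [X in _ + X - _]exchange_big /= expr2.
  have sumM (a b : I -> R) :
      \sum_i \sum_j a i * b j = (\sum_i a i) * (\sum_j b j).
    by rewrite mulr_suml; apply: eq_bigr => i _; rewrite mulr_sumr.
  rewrite (sumM (fun i => u i ^+ 2) (fun i => v i ^+ 2)).
  by rewrite (sumM (fun i => u i * v i) (fun i => u i * v i)); ring.
by rewrite pmulr_rge0 ?subr_ge0.
Qed.

(** First derivative at t = 0 of \prod_i (a i + t * b i). *)
Definition prodD1 n (a b : 'I_n -> R) : R :=
  \sum_i b i * \prod_(j | j != i) a j.

(** Second derivative at t = 0 of \prod_i (a i + t * b i). *)
Definition prodD2 n (a b : 'I_n -> R) : R :=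
  \sum_i \sum_(j | j != i) b i * b j * \prod_(k | (k != i) && (k != j)) a k.

Definition init_fun n (a : 'I_n.+1 -> R) (i : 'I_n) : R :=
  a (widen_ord (leqnSn n) i).

Lemma prod_cond_recr n (P : pred 'I_n.+1) (a : 'I_n.+1 -> R) :
  \prod_(k | P k) a k =
  (\prod_(k | P (widen_ord (leqnSn n) k)) init_fun a k) *
    (if P ord_max then a ord_max else 1).
Proof. by rewrite big_mkcond big_ord_recr /= -big_mkcond. Qed.

Lemma widen_max n (i : 'I_n) : (widen_ord (leqnSn n) i == ord_max) = false.
Proof. by rewrite -val_eqE /= ltn_eqF. Qed.

Lemma max_widen n (i : 'I_n) : (ord_max == widen_ord (leqnSn n) i) = false.
Proof. by rewrite eq_sym widen_max. Qed.

(** The product rule, the last factor a ord_max + t * b ord_max being set apart;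
this recursion and the next one are those of the derivatives of a matrix
product. *)
Lemma prodD1_recr n (a b : 'I_n.+1 -> R) :
  prodD1 a b = prodD1 (init_fun a) (init_fun b) * a ord_max +
    (\prod_k init_fun a k) * b ord_max.
Proof.
rewrite /prodD1 big_ord_recr /=; congr (_ + _).
  rewrite mulr_suml; apply: eq_bigr => i _; rewrite -mulrA; congr (_ * _).
  rewrite prod_cond_recr max_widen.
  by congr (_ * _); apply: eq_bigl => j; rewrite -!val_eqE.
rewrite mulrC prod_cond_recr eqxx mulr1; congr (_ * _).
by apply: eq_bigl => j; rewrite widen_max.
Qed.

Lemma prodD2_recr n (a b : 'I_n.+1 -> R) :
  prodD2 a b = prodD2 (init_fun a) (init_fun b) * a ord_max +
    2 * (prodD1 (init_fun a) (init_fun b) * b ord_max).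
Proof.
have inner (i : 'I_n) :
    \sum_(j | j != widen_ord (leqnSn n) i) b (widen_ord (leqnSn n) i) * b j *
      \prod_(k | (k != widen_ord (leqnSn n) i) && (k != j)) a k =
    (\sum_(j | j != i) init_fun b i * init_fun b j *
      \prod_(k | (k != i) && (k != j)) init_fun a k) * a ord_max
    + init_fun b i * (\prod_(k | k != i) init_fun a k) * b ord_max.
  rewrite big_mkcond big_ord_recr /= -big_mkcond max_widen /=; congr (_ + _).
    rewrite mulr_suml; apply: eq_big => [j|j ji]; first by rewrite -!val_eqE.
    rewrite -[RHS]mulrA; congr (_ * _); rewrite prod_cond_recr !max_widen /=.
    by congr (_ * _); apply: eq_bigl => k; rewrite -!val_eqE.
  rewrite mulrAC; congr (_ * _ * _); rewrite prod_cond_recr eqxx andbF mulr1.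
  by apply: eq_bigl => k; rewrite widen_max andbT -!val_eqE.
rewrite /prodD2 big_ord_recr /= (eq_bigr _ (fun i _ => inner i)) big_split /=.
rewrite -!mulr_suml -addrA; congr (_ + _).
rewrite [X in _ + X]big_mkcond big_ord_recr /= eqxx addr0 -big_mkcond /=.
rewrite mulrDl mul1r; congr (_ + _).
rewrite /prodD1 mulr_suml; apply: eq_big => [j|j _]; first by rewrite widen_max.
rewrite [b ord_max * _]mulrC mulrAC; congr (_ * _ * _).
rewrite prod_cond_recr eqxx mulr1.
by apply: eq_bigl => k; rewrite widen_max /= -!val_eqE.
Qed.

(** Each product is at most the mean of the two squares, and every square occurs
in 2 * (n - 1) of the terms. *)
Lemma sum_offdiag_le n (u : 'I_n -> R) :
  \sum_i \sum_(j | j != i) u i * u j <= n.-1%:R * \sum_i u i ^+ 2.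
Proof.
have le2 : \sum_i \sum_(j | j != i) u i * u j <=
    \sum_i \sum_(j | j != i) (u i ^+ 2 + u j ^+ 2) / 2.
  apply: ler_sum => i _; apply: ler_sum => j _.
  by have := sqr_ge0 (u i - u j); rewrite sqrrB !expr2; lra.
apply: le_trans le2 _.
have E1 : \sum_i \sum_(j : 'I_n | j != i) u i ^+ 2 = n.-1%:R * \sum_i u i ^+ 2.
  rewrite mulr_sumr; apply: eq_bigr => i _.
  by rewrite sumr_const cardC1 card_ord mulr_natl.
have E2 : \sum_i \sum_(j : 'I_n | j != i) u j ^+ 2 = n.-1%:R * \sum_i u i ^+ 2.
  rewrite (exchange_big_dep xpredT) //= -E1; apply: eq_bigr => i _.
  by apply: eq_bigl => j; rewrite eq_sym.
under eq_bigr do rewrite -mulr_suml big_split /=.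
by rewrite -mulr_suml big_split /= E1 E2; lra.
Qed.

Lemma prodD1_sqr_le n (a b : 'I_n -> R) :
  prodD1 a b ^+ 2 <= n%:R * \sum_i (b i * \prod_(j | j != i) a j) ^+ 2.
Proof.
have := sum_cauchy_schwarz (fun=> 1) (fun i => b i * \prod_(j | j != i) a j).
by rewrite sumr_const card_ord expr1n; under eq_bigr do rewrite mul1r.
Qed.

(** With p i = b i * \prod_(j | j != i) a j, the left-hand side is the sum of
p i * p j over i != j: the missing factors a i and a j come from the full
product. *)
Lemma prod_prodD2_le n (a b : 'I_n -> R) :
  (\prod_i a i) * prodD2 a b <=
    n.-1%:R * \sum_i (b i * \prod_(j | j != i) a j) ^+ 2.
Proof.
apply: le_trans (sum_offdiag_le _); rewrite /prodD2 mulr_sumr.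
rewrite le_eqVlt; apply/orP; left; apply/eqP.
apply: eq_bigr => i _; rewrite mulr_sumr; apply: eq_bigr => j ji.
rewrite (bigD1 i) //= [\prod_(k | k != i) a k](bigD1 j) //=.
rewrite [\prod_(k | k != j) a k](bigD1 i) 1?eq_sym //=.
rewrite [X in _ = _ * (_ * (_ * X))](eq_bigl (fun k => (k != i) && (k != j)));
  last first.
  by move=> k; rewrite andbC.
ring.
Qed.

Lemma prod_le_mean_exp (I : finType) (A : {pred I}) (E : I -> R) (S : R) :
  {in A, forall i, 0 <= E i} -> \sum_(i in A) E i <= S ->
  \prod_(i in A) E i <= (S / #|A|%:R) ^+ #|A|.
Proof.
move=> E0 leS; apply: le_trans (leif_AGM E0) _.
have S0 : 0 <= \sum_(i in A) E i by exact: sumr_ge0.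
have S_ge0 := le_trans S0 leS.
by apply: lerXn2r; rewrite ?nnegrE ?divr_ge0 // ler_wpM2r ?invr_ge0.
Qed.

Lemma fact_le_exp n : (n`! <= n ^ n)%N.
Proof.
elim: n => [|n IH] //; rewrite factS expnS leq_mul2l /=.
by apply: leq_trans IH _; case: n => // n; rewrite leq_exp2r.
Qed.

Lemma prod_others_sqr_le n (a : 'I_n -> R) i :
  \prod_(j | j != i) a j ^+ 2 <= (\sum_j a j ^+ 2) ^+ n.-1 / (n.-1)`!%:R.
Proof.
have cardA : #|(predC1 i : {pred 'I_n})| = n.-1 by rewrite cardC1 card_ord.
have := @prod_le_mean_exp _ (predC1 i) (fun j => a j ^+ 2) (\sum_j a j ^+ 2).
rewrite cardA => le_mean; apply: le_trans (le_mean _ _) _.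
- by move=> j _; exact: sqr_ge0.
- by rewrite [leRHS](bigD1 i) //= ler_wpDl ?sqr_ge0.
rewrite expr_div_n ler_wpM2l //.
  by apply: exprn_ge0; apply: sumr_ge0 => ? _; exact: sqr_ge0.
rewrite lef_pV2 ?posrE ?ltr0n ?fact_gt0 //; last first.
  by rewrite -natrX ltr0n; case: n.-1 => // k; rewrite expn_gt0.
by rewrite -natrX ler_nat fact_le_exp.
Qed.

(** The constant 2 n - 1 adds n, from the square of the sum of the numbers
p i = b i * \prod_(j | j != i) a j, to n - 1, from its off-diagonal part. *)
Lemma prodD1_sqr_prod_prodD2_le n (a b : 'I_n -> R) :
  prodD1 a b ^+ 2 + (\prod_i a i) * prodD2 a b <=
    (2 * n%:R - 1) * (\sum_i b i ^+ 2) *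
      ((\sum_i a i ^+ 2) ^+ n.-1 / (n.-1)`!%:R).
Proof.
case: n a b => [|n] a b.
  by rewrite /prodD1 /prodD2 !big_ord0 expr0n !(mul0r, mulr0, addr0).
set C := _ / _.
apply: le_trans (lerD (prodD1_sqr_le a b) (prod_prodD2_le a b)) _.
rewrite -mulrDl -mulrA.
have -> : (n.+1)%:R + (n.+1).-1%:R = 2 * n.+1%:R - 1 :> R.
  by rewrite -pred_Sn -natr1; ring.
rewrite ler_wpM2l //.
rewrite mulr_suml; apply: ler_sum => i _.
rewrite exprMn ler_wpM2l ?sqr_ge0 // -prodrXl.
exact: prod_others_sqr_le.
Qed.

(** The mean is taken over the n - 1 indices different from i, with the value 1
at j instead of the missing factor. *)
Lemma prod_two_others_le n q (a : 'I_n -> R) i j :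
  j != i -> n.-1 = q.*2 -> (forall k, 0 <= a k) ->
  \prod_(k | (k != i) && (k != j)) a k <=
    ((\sum_k a k ^+ 2 + 1) / n.-1%:R) ^+ q.
Proof.
move=> ji nq a0.
have S0 : 0 <= \sum_k a k ^+ 2 by apply: sumr_ge0 => ? _; exact: sqr_ge0.
have base0 : 0 <= (\sum_k a k ^+ 2 + 1) / n.-1%:R by rewrite divr_ge0 ?addr_ge0.
rewrite -(@ler_pXn2r _ 2) ?nnegrE ?exprn_ge0 ?prodr_ge0 //.
rewrite -exprM muln2 -nq -prodrXl.
pose E k := if k == j then 1 else a k ^+ 2.
have -> : \prod_(k | (k != i) && (k != j)) a k ^+ 2 = \prod_(k | k != i) E k.
  rewrite [RHS](bigD1 j) //= {1}/E eqxx mul1r.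
  by apply: eq_bigr => k /andP[_ /negPf kj]; rewrite /E kj.
have cardA : #|(predC1 i : {pred 'I_n})| = n.-1 by rewrite cardC1 card_ord.
have := @prod_le_mean_exp _ (predC1 i) E (\sum_k a k ^+ 2 + 1).
rewrite cardA; apply.
  by move=> k _; rewrite /E; case: ifP => // _; exact: sqr_ge0.
rewrite (bigD1 j) //= {1}/E eqxx addrC lerD2r.
rewrite [leRHS](bigID (fun k => (k != i) && (k != j))) /=.
apply: ler_wpDr; first by apply: sumr_ge0 => ? _; exact: sqr_ge0.
by apply: ler_sum => k /andP[_ /negPf kj]; rewrite /E kj.
Qed.

Lemma prodD2_le n q (a b : 'I_n -> R) :
  n.-1 = q.*2 -> (forall k, 0 <= a k) -> (forall k, 0 <= b k) ->
  prodD2 a b <= n.-1%:R * (\sum_i b i ^+ 2) *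
    ((\sum_k a k ^+ 2 + 1) / n.-1%:R) ^+ q.
Proof.
move=> nq a0 b0; set C := _ ^+ q.
have C0 : 0 <= C.
  rewrite exprn_ge0 // divr_ge0 // addr_ge0 // sumr_ge0 // => k _.
  exact: sqr_ge0.
apply: le_trans (ler_wpM2r C0 (sum_offdiag_le b)).
rewrite mulr_suml; apply: ler_sum => i _; rewrite mulr_suml.
apply: ler_sum => j ji; rewrite ler_wpM2l ?mulr_ge0 //.
exact: prod_two_others_le.
Qed.

End SumsAndProducts.

(** * The Frobenius norm *)

Section Frobenius.
Context {R : realType}.

Definition mxdot m n (A B : 'M[R]_(m, n)) : R := \sum_i \sum_j A i j * B i j.

Lemma frob_ge0 m n (A : 'M[R]_(m, n)) : 0 <= frob A.
Proof. exact: sqrtr_ge0. Qed.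

Lemma frob_sqr m n (A : 'M[R]_(m, n)) : frob A ^+ 2 = \sum_i \sum_j A i j ^+ 2.
Proof.
by rewrite sqr_sqrtr //; do 2!apply: sumr_ge0 => ? _; exact: sqr_ge0.
Qed.

Lemma mxdotxx m n (A : 'M[R]_(m, n)) : mxdot A A = frob A ^+ 2.
Proof. by rewrite frob_sqr; do 2!apply: eq_bigr => ? _; rewrite expr2. Qed.

Lemma mxdotC p q (A B : 'M[R]_(p, q)) : mxdot A B = mxdot B A.
Proof. by do 2!apply: eq_bigr => ? _; rewrite mulrC. Qed.

Lemma mxdotBl m n (A B C : 'M[R]_(m, n)) :
  mxdot (A - B) C = mxdot A C - mxdot B C.
Proof.
rewrite /mxdot -sumrB; apply: eq_bigr => i _; rewrite -sumrB.
by apply: eq_bigr => j _; rewrite !mxE mulrBl.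
Qed.

Lemma mxdot_le m n (A B : 'M[R]_(m, n)) : `|mxdot A B| <= frob A * frob B.
Proof.
have AB0 : 0 <= frob A * frob B by rewrite mulr_ge0 ?frob_ge0.
rewrite -(@ler_pXn2r _ 2) ?nnegrE // real_normK ?num_real // exprMn !frob_sqr.
rewrite /mxdot !pair_bigA /=.
exact: (sum_cauchy_schwarz (fun p => A p.1 p.2) (fun p => B p.1 p.2)).
Qed.

Lemma frob_mul m n p (A : 'M[R]_(m, n)) (B : 'M[R]_(n, p)) :
  frob (A *m B) <= frob A * frob B.
Proof.
rewrite -(@ler_pXn2r _ 2) ?nnegrE ?mulr_ge0 ?frob_ge0 // exprMn !frob_sqr.
rewrite mulr_suml; apply: ler_sum => i _.
rewrite [\sum_i \sum_j B i j ^+ 2]exchange_big mulr_sumr /=.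
by apply: ler_sum => j _; rewrite mxE; exact: sum_cauchy_schwarz.
Qed.

Lemma frob_add m n (A B : 'M[R]_(m, n)) : frob (A + B) <= frob A + frob B.
Proof.
rewrite -(@ler_pXn2r _ 2) ?nnegrE ?addr_ge0 ?frob_ge0 // sqrrD.
have -> : frob (A + B) ^+ 2 = frob A ^+ 2 + mxdot A B *+ 2 + frob B ^+ 2.
  rewrite !frob_sqr /mxdot -sumrMnl -!big_split; apply: eq_bigr => i _ /=.
  rewrite -sumrMnl -!big_split; apply: eq_bigr => j _ /=.
  by rewrite mxE sqrrD.
by rewrite lerD2r lerD2l lerMn2r (le_trans (ler_norm _) (mxdot_le _ _)).
Qed.

End Frobenius.

(** * Derivatives of a product of matrices *)

Section ProductDerivatives.
Context {R : realType}.

Definition init_weights N d (W : @weights R N.+1 d) : weights N d :=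
  fun i => W (widen_ord (leqnSn N) i).

(** First derivative at t = 0 of the product of the matrices W i + t * V i.  As
in the product itself, the last layer is split off. *)
Fixpoint mxprodD1 N d : @weights R N d -> weights N d -> 'M[R]_(d 0%N, d N) :=
  match N with
  | 0 => fun _ _ => 0
  | n.+1 => fun W V =>
      mxprodD1 (init_weights W) (init_weights V) *m W ord_max +
      mxprod (init_weights W) *m V ord_max
  end.

(** Second derivative at t = 0 of the product of the matrices W i + t * V i. *)
Fixpoint mxprodD2 N d : @weights R N d -> weights N d -> 'M[R]_(d 0%N, d N) :=
  match N with
  | 0 => fun _ _ => 0
  | n.+1 => fun W V =>
      mxprodD2 (init_weights W) (init_weights V) *m W ord_max +
      (mxprodD1 (init_weights W) (init_weights V) *m V ord_max +
       mxprodD1 (init_weights W) (init_weights V) *m V ord_max)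
  end.

(** There must be at least one layer: the empty product is the identity matrix,
whose norm may exceed 1. *)
Lemma frob_mxprod N d (W : @weights R N.+1 d) :
  frob (mxprod W) <= \prod_i frob (W i).
Proof.
elim: N W => [|N IH] W; first by rewrite big_ord_recr big_ord0 /= mul1mx mul1r.
rewrite big_ord_recr /=; apply: le_trans (frob_mul _ _) _.
by rewrite ler_wpM2r ?frob_ge0 //; exact: IH.
Qed.

Lemma frob_mxprodD1 N d (W V : @weights R N.+1 d) :
  frob (mxprodD1 W V) <= prodD1 (fun i => frob (W i)) (fun i => frob (V i)).
Proof.
elim: N W V => [|N IH] W V; rewrite prodD1_recr.
  rewrite /prodD1 !big_ord0 mul0r add0r mul1r.
  by rewrite /= mul0mx add0r mul1mx.
apply: le_trans (frob_add _ _) _; apply: lerD.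
  apply: le_trans (frob_mul _ _) _; rewrite ler_wpM2r ?frob_ge0 //.
  exact: IH.
apply: le_trans (frob_mul _ _) _; rewrite ler_wpM2r ?frob_ge0 //.
exact: frob_mxprod.
Qed.

Lemma frob_mxprodD2 N d (W V : @weights R N.+1 d) :
  frob (mxprodD2 W V) <= prodD2 (fun i => frob (W i)) (fun i => frob (V i)).
Proof.
elim: N W V => [|N IH] W V; rewrite prodD2_recr.
  rewrite /prodD1 /prodD2 !big_ord0 !mul0r mulr0 addr0 /= !mul0mx !addr0.
  rewrite /frob big1 ?sqrtr0 // => i _.
  by rewrite big1 // => j _; rewrite mxE expr0n.
rewrite mulr2n mulrDl mul1r.
apply: le_trans (frob_add _ _) _; apply: lerD.
  apply: le_trans (frob_mul _ _) _; rewrite ler_wpM2r ?frob_ge0 //.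
  exact: IH.
apply: le_trans (frob_add _ _) _.
by apply: lerD; apply: le_trans (frob_mul _ _) _;
  rewrite ler_wpM2r ?frob_ge0 //; exact: frob_mxprodD1.
Qed.

Section calculus.
Context {m : nat}.
Implicit Types (x v : 'rV[R]_m).

(** Entrywise, since the matrices that occur here have no common normed space:
their dimensions vary with the layer. *)
Definition mx_derive p q x v (A : 'rV[R]_m -> 'M[R]_(p, q))
    (dA : 'M[R]_(p, q)) :=
  forall i j, is_derive x v (fun y => A y i j) (dA i j).

Lemma mx_derive_cst p q x v (A : 'M[R]_(p, q)) : mx_derive x v (fun=> A) 0.
Proof. by move=> i j; rewrite mxE; exact: is_derive_cst. Qed.

Lemma mx_deriveD p q x v (A B : 'rV[R]_m -> 'M[R]_(p, q)) dA dB :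
  mx_derive x v A dA -> mx_derive x v B dB ->
  mx_derive x v (fun y => A y + B y) (dA + dB).
Proof.
move=> HA HB i j; rewrite mxE.
rewrite (_ : (fun _ => _) = (fun y => A y i j) + (fun y => B y i j)).
  exact: is_deriveD.
by apply/funext => y; rewrite mxE.
Qed.

Lemma mx_deriveM p q r x v (A : 'rV[R]_m -> 'M[R]_(p, q))
    (B : 'rV[R]_m -> 'M[R]_(q, r)) dA dB :
  mx_derive x v A dA -> mx_derive x v B dB ->
  mx_derive x v (fun y => A y *m B y) (dA *m B x + A x *m dB).
Proof.
move=> HA HB i j; rewrite !mxE -big_split /=.
rewrite (_ : (fun _ => _) = fun y => \sum_k A y i k * B y k j).
  by apply: is_derive_bigsum => k; exact: is_derive_mul.
by apply/funext => y; rewrite mxE.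
Qed.

Lemma mx_deriveMr p q r x v (A : 'rV[R]_m -> 'M[R]_(p, q)) dA
    (B : 'M[R]_(q, r)) :
  mx_derive x v A dA -> mx_derive x v (fun y => A y *m B) (dA *m B).
Proof.
move=> HA; rewrite -[dA *m B]addr0 -(mulmx0 r (A x)).
by apply: mx_deriveM; last exact: mx_derive_cst.
Qed.

Lemma is_derive_mxdot p q x v (A B : 'rV[R]_m -> 'M[R]_(p, q)) dA dB :
  mx_derive x v A dA -> mx_derive x v B dB ->
  is_derive x v (fun y => mxdot (A y) (B y)) (mxdot dA (B x) + mxdot (A x) dB).
Proof.
move=> HA HB; rewrite /mxdot -big_split /=; apply: is_derive_bigsum => i.
by rewrite -big_split /=; apply: is_derive_bigsum => j; exact: is_derive_mul.
Qed.

Lemma mx_derive_mxprod N d (W : 'rV[R]_m -> weights N d) V x v :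
  (forall i, mx_derive x v (fun y => W y i) (V i)) ->
  mx_derive x v (fun y => mxprod (W y)) (mxprodD1 (W x) V).
Proof.
elim: N W V => [|n IH] W V dW /=; first exact: mx_derive_cst.
apply: mx_deriveM; last exact: (dW ord_max).
by apply: IH => i; exact: (dW (widen_ord _ i)).
Qed.

Lemma mx_derive_mxprodD1 N d (W : 'rV[R]_m -> weights N d) V x v :
  (forall i, mx_derive x v (fun y => W y i) (V i)) ->
  mx_derive x v (fun y => mxprodD1 (W y) V) (mxprodD2 (W x) V).
Proof.
elim: N W V => [|n IH] W V dW /=; first exact: mx_derive_cst.
rewrite addrA; apply: mx_deriveD.
  apply: mx_deriveM; first by apply: IH => i; exact: (dW (widen_ord _ i)).
  exact: (dW ord_max).
have -> : mxprodD1 (init_weights (W x)) (init_weights V) *m V ord_max =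
    mxprodD1 (init_weights (W x)) (init_weights V) *m V ord_max +
    mxprod (init_weights (W x)) *m 0 by rewrite mulmx0 addr0.
apply: mx_deriveM; last exact: mx_derive_cst.
by apply: mx_derive_mxprod => i; exact: (dW (widen_ord _ i)).
Qed.

Definition polynomial_mx p q (A : 'rV[R]_m -> 'M[R]_(p, q)) :=
  forall i j, polynomial_function (fun x => A x i j).

Lemma polymx_mul p q r (A : 'rV[R]_m -> 'M[R]_(p, q))
    (B : 'rV[R]_m -> 'M[R]_(q, r)) :
  polynomial_mx A -> polynomial_mx B -> polynomial_mx (fun x => A x *m B x).
Proof.
move=> pA pB i j.
rewrite (_ : (fun _ => _) = fun x => \sum_k A x i k * B x k j).
  by apply: polyfun_sum => k; exact: polyfun_mul.
by apply/funext => x; rewrite mxE.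
Qed.

Lemma polymx_mxprod n e (W : 'rV[R]_m -> weights n e) :
  (forall i, polynomial_mx (fun x => W x i)) ->
  polynomial_mx (fun x => mxprod (W x)).
Proof.
elim: n W => [|n IH] W pW /=; first by move=> i j; exact: polyfun_cst.
apply: polymx_mul; last exact: (pW ord_max).
by apply: IH => i; exact: (pW (widen_ord _ i)).
Qed.

End calculus.
End ProductDerivatives.

(** * The loss *)

Section Loss.
Context {R : realType}.
Variables (N : nat) (d : nat -> nat) (nT : nat).
Variables (X : 'M[R]_(d N, nT)) (Y : 'M[R]_(d 0%N, nT)).
Local Notation m := (wdim N d).
Implicit Types (x v : 'rV[R]_m).

Lemma weights_of_vecE x i a b : exists k, forall y : 'rV[R]_m,
  weights_of_vec y i a b = y 0 k.
Proof. by eexists => y; rewrite !mxE. Qed.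

Lemma mx_derive_weights x v i :
  mx_derive x v (fun y => weights_of_vec y i) (weights_of_vec v i).
Proof.
move=> a b; have [k Ek] := weights_of_vecE x a b.
rewrite Ek (_ : (fun _ => _) = fun y : 'rV_m => y 0 k).
  exact: is_derive_coord.
by apply/funext => y; rewrite Ek.
Qed.

Definition lossD x v : R :=
  mxdot (mxprod (weights_of_vec x) *m X - Y)
        (mxprodD1 (weights_of_vec x) (weights_of_vec v) *m X).

Definition lossD2 x v : R :=
  frob (mxprodD1 (weights_of_vec x) (weights_of_vec v) *m X) ^+ 2 +
  mxdot (mxprod (weights_of_vec x) *m X - Y)
        (mxprodD2 (weights_of_vec x) (weights_of_vec v) *m X).

Lemma mx_derive_residual x v :
  mx_derive x v (fun y => mxprod (weights_of_vec y) *m X - Y)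
    (mxprodD1 (weights_of_vec x) (weights_of_vec v) *m X).
Proof.
rewrite -[X in mx_derive _ _ _ X]addr0.
apply: mx_deriveD; last exact: mx_derive_cst.
by apply: mx_deriveMr; apply: mx_derive_mxprod => i; exact: mx_derive_weights.
Qed.

Lemma is_derive_loss x v :
  is_derive x v (fun y => loss X Y (weights_of_vec y)) (lossD x v).
Proof.
rewrite (_ : (fun _ => _) = fun y => 2^-1 *
    mxdot (mxprod (weights_of_vec y) *m X - Y)
          (mxprod (weights_of_vec y) *m X - Y)).
  have dE := mx_derive_residual x v.
  have := is_derive_scale 2^-1 (is_derive_mxdot dE dE).
  rewrite mxdotC -/(lossD x v) (_ : 2^-1 * _ = lossD x v) //.
  by lra.
by apply/funext => y; rewrite mxdotxx.
Qed.

Lemma is_derive_lossD x v : is_derive x v (lossD ^~ v) (lossD2 x v).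
Proof.
rewrite /lossD2 -mxdotxx.
apply: is_derive_mxdot; first exact: mx_derive_residual.
by apply: mx_deriveMr; apply: mx_derive_mxprodD1 => i; exact: mx_derive_weights.
Qed.

Lemma polyfun_loss : polynomial_function (fun x => loss X Y (weights_of_vec x)).
Proof.
rewrite (_ : (fun _ => _) = fun x => 2^-1 * \sum_i \sum_j
    ((mxprod (weights_of_vec x) *m X) i j + - Y i j) ^+ 2); last first.
  apply/funext => x; rewrite /loss frob_sqr; congr (_ * _).
  by do 2!apply: eq_bigr => ? _; rewrite [in LHS]mxE [(- Y) _ _]mxE.
apply: polyfun_mul; first exact: polyfun_cst.
apply: polyfun_sum => i; apply: polyfun_sum => j; apply: polyfun_exp.
apply: polyfun_add; last exact: polyfun_cst.
move: i j; apply: polymx_mul; last by move=> i j; exact: polyfun_cst.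
apply: polymx_mxprod => i a b; have [k Ek] := weights_of_vecE 0 a b.
rewrite (_ : (fun _ => _) = fun y : 'rV_m => y 0 k); first exact: polyfun_coord.
by apply/funext => y; rewrite Ek.
Qed.

End Loss.

Section LossBound.
Context {R : realType}.
Variables (N : nat) (d : nat -> nat) (nT : nat).
Variables (X : 'M[R]_(d N.+1, nT)) (Y : 'M[R]_(d 0%N, nT)).
Implicit Types (x v : 'rV[R]_(wdim N.+1 d)).

(** The first term bounds |A' X|^2 + <A X, A'' X> and the second one <Y, A'' X>,
where A is the product of the layers. *)
Lemma lossD2_le x v q : N = q.*2 ->
  `|lossD2 X Y x v| <=
    (2 * N.+1%:R - 1) * frob X ^+ 2 * (dotv x x ^+ N / N`!%:R) * dotv v v +
    N%:R * frob Y * frob X * ((dotv x x + 1) / N%:R) ^+ q * dotv v v.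
Proof.
move=> Nq; rewrite -!normsq_weights_of_vec /normsq /lossD2.
set W := weights_of_vec x; set V := weights_of_vec v.
pose a i := frob (W i); pose b i := frob (V i).
have a0 i : 0 <= a i by exact: frob_ge0.
have b0 i : 0 <= b i by exact: frob_ge0.
have A0 : frob (mxprod W) <= \prod_i a i by exact: frob_mxprod.
have A1 : frob (mxprodD1 W V) <= prodD1 a b by exact: frob_mxprodD1.
have A2 : frob (mxprodD2 W V) <= prodD2 a b by exact: frob_mxprodD2.
have S1 := prodD1_sqr_prod_prodD2_le a b.
have S2 := prodD2_le (n := N.+1) Nq a0 b0.
have X0 := frob_ge0 X; have Y0 := frob_ge0 Y.
rewrite mxdotBl.
have T1 : `|frob (mxprodD1 W V *m X) ^+ 2| <= prodD1 a b ^+ 2 * frob X ^+ 2.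
  rewrite ger0_norm ?sqr_ge0 // -exprMn.
  rewrite ler_pXn2r ?nnegrE ?mulr_ge0 ?frob_ge0 //; last first.
    exact: le_trans (frob_ge0 _) A1.
  by apply: le_trans (frob_mul _ _) _; rewrite ler_wpM2r.
have T2 : `|mxdot (mxprod W *m X) (mxprodD2 W V *m X)| <=
    (\prod_i a i) * prodD2 a b * frob X ^+ 2.
  apply: le_trans (mxdot_le _ _) _; rewrite expr2 mulrACA.
  by apply: ler_pM; rewrite ?frob_ge0 //; apply: le_trans (frob_mul _ _) _;
    rewrite ler_wpM2r.
have T3 : `|mxdot Y (mxprodD2 W V *m X)| <= frob Y * (prodD2 a b * frob X).
  apply: le_trans (mxdot_le _ _) _; rewrite ler_wpM2l //.
  by apply: le_trans (frob_mul _ _) _; rewrite ler_wpM2r.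
apply: le_trans (ler_normD _ _) _.
apply: le_trans (lerD T1 (le_trans (ler_normB _ _) (lerD T2 T3))) _.
rewrite addrA -mulrDl; apply: lerD.
  apply: le_trans (ler_wpM2r (sqr_ge0 (frob X)) S1) _.
  by rewrite le_eqVlt; apply/orP; left; apply/eqP; rewrite -pred_Sn /a /b; ring.
have -> : frob Y * (prodD2 a b * frob X) = frob Y * frob X * prodD2 a b by ring.
apply: le_trans (ler_wpM2l (mulr_ge0 Y0 X0) S2) _.
by rewrite le_eqVlt; apply/orP; left; apply/eqP; rewrite -pred_Sn /a /b; ring.
Qed.

End LossBound.

(** * Powers of the squared norm *)

Section RadialPowers.
Context {R : realType} {m : nat}.
Implicit Types (x v : 'rV[R]_m).

Lemma dotv_ge0 x : 0 <= dotv x x.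
Proof. by apply: sumr_ge0 => i _; rewrite -expr2 sqr_ge0. Qed.

Lemma is_derive_dotv x v (u : 'rV[R]_m) : is_derive x v (dotv ^~ u) (dotv v u).
Proof.
apply: is_derive_bigsum => i.
have := is_derive_mul (is_derive_coord x v i) (is_derive_cst (u 0 i) x v).
by rewrite mulr0 addr0.
Qed.

Lemma is_derive_dotvv x v : is_derive x v (fun y => dotv y y) (2 * dotv x v).
Proof.
rewrite /dotv mulr_sumr; apply: is_derive_bigsum => i.
have := is_derive_mul (is_derive_coord x v i) (is_derive_coord x v i).
by rewrite [v 0 i * _]mulrC -mulr2n mulr_natl.
Qed.

Lemma polyfun_dotvv : polynomial_function (fun x : 'rV[R]_m => dotv x x).
Proof.
by apply: polyfun_sum => i; apply: polyfun_mul; exact: polyfun_coord.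
Qed.

Variables (c K : R).
Let base x := (dotv x x + c) / K.

Definition radial_powD n x v := n%:R * base x ^+ n.-1 * (2 * dotv x v / K).

Definition radial_powD2 n x v :=
  n%:R * (n.-1%:R * base x ^+ n.-2 * (2 * dotv x v / K)) * (2 * dotv x v / K) +
  n%:R * base x ^+ n.-1 * (2 * dotv v v / K).

Lemma is_derive_radial x v : is_derive x v base (2 * dotv x v / K).
Proof.
rewrite /base (_ : (fun _ => _) = fun y => K^-1 * (dotv y y + c)); last first.
  by apply/funext => y; rewrite mulrC.
rewrite [_ / K]mulrC; apply: is_derive_scale.
rewrite -[X in is_derive _ _ _ X]addr0.
by apply: is_deriveD; exact: is_derive_dotvv.
Qed.

Lemma is_derive_radial_pow n x v :
  is_derive x v (fun y => base y ^+ n) (radial_powD n x v).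
Proof.
rewrite (_ : (fun _ => _) = base ^+ n).
  exact: is_deriveX (is_derive_radial x v).
by apply/funext => y; rewrite exprfctE.
Qed.

Lemma is_derive_radial_powD n x v :
  is_derive x v (radial_powD n ^~ v) (radial_powD2 n x v).
Proof.
rewrite /radial_powD /radial_powD2.
apply: is_derive_mul.
  by apply: is_derive_scale; exact: is_derive_radial_pow.
rewrite (_ : (fun _ => _) = fun y => (2 / K) * dotv y v); last first.
  by apply/funext => y; rewrite mulrAC.
rewrite (mulrAC 2); apply: is_derive_scale; exact: is_derive_dotv.
Qed.

(** The left-hand side is the part of the second derivative that contains
dotv v v; the other part is a nonnegative multiple of the square of
dotv x v. *)
Lemma radial_powD2_ge n x v : 0 <= c -> 0 < K ->
  2 * n%:R / K * base x ^+ n.-1 * dotv v v <= radial_powD2 n x v.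
Proof.
move=> c0 K0.
have b0 : 0 <= base x by rewrite divr_ge0 ?addr_ge0 ?dotv_ge0 // ltW.
have -> : 2 * n%:R / K * base x ^+ n.-1 * dotv v v =
          n%:R * base x ^+ n.-1 * (2 * dotv v v / K) by ring.
rewrite /radial_powD2 lerDr.
have -> : n%:R * (n.-1%:R * base x ^+ n.-2 * (2 * dotv x v / K)) *
    (2 * dotv x v / K) =
  n%:R * n.-1%:R * base x ^+ n.-2 * (2 * dotv x v / K) ^+ 2 by ring.
apply: mulr_ge0; last exact: sqr_ge0.
by apply: mulr_ge0; [rewrite mulr_ge0|exact: exprn_ge0].
Qed.

Lemma polyfun_radial_pow n : polynomial_function (fun x => base x ^+ n).
Proof.
apply: polyfun_exp; apply: polyfun_mul; last exact: polyfun_cst.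
by apply: polyfun_add; [exact: polyfun_dotvv|exact: polyfun_cst].
Qed.

End RadialPowers.

(** * Second derivative of the kernel *)

Section KernelHb.
Context {R : realType}.
Variables (q : nat) (d : nat -> nat) (nT : nat).
Local Notation N := (q.*2.+1).
Variables (X : 'M[R]_(d N, nT)) (Y : 'M[R]_(d 0%N, nT)).
Implicit Types (x v : 'rV[R]_(wdim N d)).

Lemma c3E : c3 X Y =
  frob Y * frob X * q.*2%:R * ((N%:R + 1) / q.*2%:R) ^+ q.
Proof.
have e1 : N%:R - 1 = q.*2%:R :> R by rewrite -natr1 addrK.
have e2 : q.*2%:R / 2 = q%:R :> R by rewrite -muln2 natrM mulfK ?pnatr_eq0.
by rewrite /c3 e1 e2 !powR_mulrn ?addr_ge0 // expr_div_n mulrA.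
Qed.

Lemma H3E x : H3 (weights_of_vec x) = ((dotv x x + 1) / (N%:R + 1)) ^+ q.+1.
Proof.
have e2 : (N%:R + 1) / 2 = q.+1%:R :> R.
  by rewrite natr1 -doubleS -muln2 natrM mulfK ?pnatr_eq0.
rewrite /H3 e2 normsq_weights_of_vec powR_mulrn //.
by rewrite divr_ge0 ?addr_ge0 ?dotv_ge0.
Qed.

Lemma HbE x : Hb X Y (weights_of_vec x) =
  c1 X * ((dotv x x + 0) / N%:R) ^+ N +
  c3 X Y * ((dotv x x + 1) / (N%:R + 1)) ^+ q.+1.
Proof. by rewrite /Hb H3E /H1 normsq_weights_of_vec addr0. Qed.

Definition HbD x v : R :=
  c1 X * radial_powD 0 N%:R N x v + c3 X Y * radial_powD 1 (N%:R + 1) q.+1 x v.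

Definition HbD2 x v : R :=
  c1 X * radial_powD2 0 N%:R N x v +
  c3 X Y * radial_powD2 1 (N%:R + 1) q.+1 x v.

Lemma is_derive_Hb x v :
  is_derive x v (fun y => Hb X Y (weights_of_vec y)) (HbD x v).
Proof.
rewrite (funext HbE).
by apply: is_deriveD; apply: is_derive_scale; exact: is_derive_radial_pow.
Qed.

Lemma is_derive_HbD x v : is_derive x v (HbD ^~ v) (HbD2 x v).
Proof.
by apply: is_deriveD; apply: is_derive_scale; exact: is_derive_radial_powD.
Qed.

Lemma polyfun_Hb : polynomial_function (fun x => Hb X Y (weights_of_vec x)).
Proof.
rewrite (funext HbE); apply: polyfun_add; apply: polyfun_mul;
  solve [exact: polyfun_cst | exact: polyfun_radial_pow].
Qed.

Lemma c1_ge0 : 0 <= c1 X.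
Proof. by rewrite mulr_ge0 ?sqr_ge0 // divr_ge0 ?mulr_ge0 ?exprn_ge0. Qed.

Lemma c3_ge0 : 0 <= c3 X Y.
Proof.
by rewrite c3E !mulr_ge0 ?frob_ge0 // exprn_ge0 // divr_ge0 ?addr_ge0.
Qed.

(** This is where the values of c1 and c3 come from: they make the lower bound
that [radial_powD2_ge] gives for the right-hand side equal to the left-hand
side, the bound of [lossD2_le]. *)
Lemma HbD2_ge x v : (0 < q)%N ->
  (2 * N%:R - 1) * frob X ^+ 2 * (dotv x x ^+ q.*2 / (q.*2)`!%:R) * dotv v v +
  q.*2%:R * frob Y * frob X * ((dotv x x + 1) / q.*2%:R) ^+ q * dotv v v
  <= HbD2 x v.
Proof.
move=> q0.
have Npos : 0 < N%:R :> R by rewrite ltr0n.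
have N1pos : 0 < N%:R + 1 :> R by rewrite addr_gt0.
have h1 := ler_wpM2l c1_ge0 (radial_powD2_ge N x v (lexx 0) Npos).
have h3 := ler_wpM2l c3_ge0 (radial_powD2_ge q.+1 x v ler01 N1pos).
apply: le_trans (lerD h1 h3); rewrite -!pred_Sn.
rewrite le_eqVlt; apply/orP; left; apply/eqP; congr (_ + _).
  have f0 : (q.*2)`!%:R != 0 :> R by rewrite pnatr_eq0 -lt0n fact_gt0.
  rewrite /c1 factS natrM addr0 expr_div_n (exprS N%:R).
  have NN0 : N%:R ^+ q.*2 != 0 :> R by rewrite expf_neq0 ?pnatr_eq0.
  have N0 : N%:R != 0 :> R by rewrite pnatr_eq0.
  move: (N%:R) (N%:R ^+ q.*2) (dotv x x ^+ q.*2) ((q.*2)`!%:R) NN0 N0 f0.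
  move=> n P S F.
  by move=> P0 n0 F0; field; rewrite P0 F0 n0.
have -> : 2 * q.+1%:R / (N%:R + 1) = 1 :> R.
  have -> : N%:R + 1 = 2 * q.+1%:R :> R.
    by rewrite natr1 -doubleS -muln2 natrM mulrC.
  by rewrite divff // mulf_neq0 ?pnatr_eq0.
rewrite c3E mul1r.
have -> : (dotv x x + 1) / q.*2%:R =
    ((N%:R + 1) / q.*2%:R) * ((dotv x x + 1) / (N%:R + 1)) :> R.
  rewrite mulrACA [in RHS]mulrC; field.
  by rewrite gt_eqF //= pnatr_eq0 double_eq0 -lt0n.
by rewrite exprMn; ring.
Qed.

End KernelHb.

Theorem proposition8 (R : realType) (N : nat) (d : nat -> nat) (nT : nat)
    (hN : (2 < N)%N) (hodd : odd N)
    (hd : forall i, (i <= N)%N -> (0 < d i)%N) (hnT : (0 < nT)%N)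
    (X : 'M[R]_(d N, nT)) (Y : 'M[R]_(d 0%N, nT)) :
  kernel_generating_distance [set: 'rV[R]_(wdim N d)]
    (fun x => (Hb X Y (weights_of_vec x))%:E)
  /\ smad 1 (fun x : 'rV[R]_(wdim N d) => loss X Y (weights_of_vec x))
       (fun x => Hb X Y (weights_of_vec x)).
Proof.
have [q eqN] : exists q, N = q.*2.+1.
  by exists N./2; rewrite -[LHS]odd_double_half hodd.
subst N; have q0 : (0 < q)%N by case: q hN {hodd hd X}.
have le_norm x v : `|lossD2 X Y x v| <= HbD2 X Y x v.
  exact: le_trans (lossD2_le X Y x v erefl) (HbD2_ge X Y x v q0).
have HbD2_ge0 x v : 0 <= HbD2 X Y x v.
  exact: le_trans (normr_ge0 _) (le_norm x v).
split.
  exact: (kgd_polyfun (polyfun_Hb X Y) (is_derive_Hb X Y) (is_derive_HbD X Y)).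
apply: (smad_polyfun ltr01 (polyfun_Hb X Y) (polyfun_loss X Y)
  (is_derive_Hb X Y) (is_derive_HbD X Y)
  (is_derive_loss X Y) (is_derive_lossD X Y)).
by move=> x v; rewrite mul1r.
Qed.
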